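(* There exists a universal constant $C>0$ such that for every positive integer $k$ and every finite group $G$ the following holds. Let $g_1,\dots,g_k\in G$ be chosen independently and uniformly at random, and consider the Cayley multigraph on $G$ with generator multiset $\{g_1,g_1^{-1},\dots,g_k,g_k^{-1}\}$ (taken with multiplicity). Then with probability at least $1/2$, for every $X\subseteq G$ with $1<|X|\le |G|/2$, \[ \left|\frac{e(X,G\setminus X)}{\frac{2k}{|G|}|X||G\setminus X|}-1\right|\le C\sqrt{\frac{\log|X|}{k}}. \]
   Context: In the Cayley multigraph, each $x\in G$ is joined to $sx$ for each element $s$ of the multiset $\{g_1,g_1^{-1},\dots,g_k,g_k^{-1}\}$, counted with multiplicity. $e(X,G\setminus X)$ denotes the number of edges (with multiplicity) with one endpoint in $X$ and the other in $G\setminus X$, i.e. the number of pairs $(x,s)$ with $x\in X$, $s$ an element of the multiset (counted with multiplicity), and $sx\notin X$. *)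

(* Defs.v *)
From HB Require Import structures.
From mathcomp Require Import all_boot all_order all_algebra all_fingroup.
From mathcomp Require Import reals exp.

Set Implicit Arguments.
Unset Strict Implicit.
Unset Printing Implicit Defensive.

Import Order.TTheory GRing.Theory Num.Theory.
Local Open Scope ring_scope.

(* The multiset {g_1, g_1^-1, ..., g_k, g_k^-1}, as a sequence with
   repetitions; its length is always 2k. *)
Definition cayley_gens (gT : finGroupType) (k : nat) (g : {ffun 'I_k -> gT}) :
    seq gT :=
  flatten [seq [:: g i; (g i)^-1%g] | i <- enum 'I_k].

(* Number of pairs (x, s), s counted with multiplicity, with x in X and s x in
   Y.  For disjoint X and Y this is the number e(X, Y) of edges of the Cayley
   multigraph with one endpoint in X and the other in Y, each edge being counted
   once, from its endpoint in X. *)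
Definition cayley_edges (gT : finGroupType) (k : nat) (g : {ffun 'I_k -> gT})
    (X Y : {set gT}) : nat :=
  (\sum_(x in X) count (fun s => (s * x)%g \in Y) (cayley_gens g))%N.

(* Probability of the event E when g_1, ..., g_k are independent and each
   uniform on gT: the mass of g is the product of the masses 1/|gT| of the
   g_i. *)
Definition iid_uniform_prob (R : realType) (gT : finGroupType) (k : nat)
    (E : pred {ffun 'I_k -> gT}) : R :=
  \sum_(g | E g) \prod_(i < k) (#|gT|%:R)^-1.

(* Main.v *)
Require Import Defs.
From HB Require Import structures.
From mathcomp Require Import all_boot all_order all_algebra all_fingroup.
From mathcomp Require Import reals sequences exp.
From mathcomp Require Import ring lra.

Set Implicit Arguments.
Unset Strict Implicit.
Unset Printing Implicit Defensive.

Import Order.TTheory GRing.Theory Num.Theory.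
Local Open Scope ring_scope.

(** Let [A] be the adjacency operator of the Cayley multigraph, let [m = |X|],
    [n = |G|], and let [f] be the indicator function of [X] minus its mean
    [m / n].  The deviation to be bounded is [- <f, A f> / (2k <f, f>)].
    Iterating the Cauchy-Schwarz inequality gives, for [N] a power of two,
    [|<f, A f>|^N <= <f, f>^(N-1) <f, A^N f>], and since the graph is vertex
    transitive, [<f, A^N f> <= m^2 t_N], where [t_N] is the number of words of
    length [N] in the generators and their inverses with value 1, minus its
    average over all target values.  A word in which some [g_i] occurs exactly
    once contributes 0 to the expectation of [t_N], so [E t_N] is at most the
    number of words without such an [i], which is at most [(256 k N)^(N/2)] when
    [N <= k].  Markov's inequality, a union bound over [N] and the choice of [N]
    of order [log m] conclude: [m^(1/N)] is then bounded, which is why only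
    [log |X|], and not [log |G|], appears.  When [N > k] the bound is trivial. *)

(** * Sums over words, peeled off one letter at a time *)

Lemma big_tuple_cons (V : nmodType) (T : finType) (r : nat) (F : seq T -> V) :
  \sum_(w : r.+1.-tuple T) F w = \sum_(s : T) \sum_(w : r.-tuple T) F (s :: w).
Proof.
rewrite pair_big /=.
rewrite (reindex (fun p : T * r.-tuple T => [tuple of p.1 :: p.2])) //=.
exists (fun w : r.+1.-tuple T => (thead w, [tuple of behead w])) => [[s w]|w] _ /=.
  by congr pair; apply: val_inj.
by rewrite [RHS]tuple_eta.
Qed.

Lemma big_tuple0 (V : nmodType) (T : finType) (F : seq T -> V) :
  \sum_(w : 0.-tuple T) F w = F [::].
Proof.
rewrite (big_pred1 [tuple]) //= => w.
by rewrite [w]tuple0; apply/esym/eqP.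
Qed.

(** * Cauchy-Schwarz on a finite set *)

Section Quadratic.

Variables (R : realFieldType) (T : finType).
Implicit Types a b : T -> R.

Definition dot a b := \sum_x a x * b x.

Lemma dot_ge0 a : 0 <= dot a a.
Proof. by apply: sumr_ge0 => x _; rewrite -expr2 sqr_ge0. Qed.

(** Lagrange's identity: the double sum of squares below expands to twice the difference of the two
    sides. *)
Lemma dot_CauchySchwarz a b : dot a b ^+ 2 <= dot a a * dot b b.
Proof.
have : 0 <= \sum_x \sum_y (a x * b y - a y * b x) ^+ 2.
  by do 2! apply: sumr_ge0 => ? _; apply: sqr_ge0.
under eq_bigr => x _.
  under eq_bigr => y _.
    rewrite (_ : _ ^+ 2 = a x * a x * (b y * b y) + b x * b x * (a y * a y)
                          - (a x * b x *+ 2) * (a y * b y)); last by ring.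
    over.
  rewrite sumrB big_split /= -!mulr_sumr.
  over.
rewrite sumrB big_split /= -!mulr_suml sumrMnl -/(dot _ _) -/(dot _ _) -/(dot _ _).
by rewrite expr2; lra.
Qed.

Lemma sqr_sum_le (X : {set T}) a :
  (\sum_(x in X) a x) ^+ 2 <= #|X|%:R * \sum_(x in X) a x ^+ 2.
Proof.
have := dot_CauchySchwarz (fun x => (x \in X)%:R) (fun x => (x \in X)%:R * a x).
congr (_ ^+ 2 <= _ * _).
- rewrite [RHS]big_mkcond; apply: eq_bigr => x _.
  by case: (x \in X); rewrite ?mul1r ?mul0r.
- rewrite -sum1_card natr_sum [RHS]big_mkcond; apply: eq_bigr => x _.
  by case: (x \in X); rewrite ?mul1r ?mul0r.
- rewrite [RHS]big_mkcond; apply: eq_bigr => x _.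
  by case: (x \in X); rewrite ?mul1r ?mul0r ?expr2.
Qed.

End Quadratic.

(** * Adjacency operator and its moments *)

Section Words.

Variables (R : realType) (gT : finGroupType) (k : nat).
Implicit Types (g : {ffun 'I_k -> gT}) (phi psi : gT -> R).

Definition letter_val g (s : 'I_k * bool) : gT :=
  if s.2 then g s.1 else (g s.1)^-1%g.

Definition word_val g (w : seq ('I_k * bool)) : gT :=
  (\prod_(s <- w) letter_val g s)%g.

Definition adj g phi (x : gT) : R := \sum_s phi (letter_val g s * x)%g.

Lemma iter_adjE g r phi x :
  iter r (adj g) phi x = \sum_(w : r.-tuple _) phi (word_val g w * x)%g.
Proof.
elim: r phi x => [|r IH] phi x.
  by rewrite (big_tuple0 (fun w => phi (word_val g w * x)%g)) /word_val big_nil mul1g.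
rewrite iterSr IH (big_tuple_cons _ (fun w => phi (word_val g w * x)%g)) exchange_big.
by apply: eq_bigr => w _; apply: eq_bigr => s _; rewrite /word_val big_cons mulgA.
Qed.

(** The letters are closed under inversion: flip the boolean of the letter, then translate [x] by
    it. *)
Lemma adj_selfadjoint g phi psi : dot (adj g phi) psi = dot phi (adj g psi).
Proof.
rewrite /dot /adj.
under eq_bigr do rewrite mulr_suml.
under [RHS]eq_bigr do rewrite mulr_sumr.
rewrite exchange_big [RHS]exchange_big /=.
rewrite (reindex (fun s : 'I_k * bool => (s.1, ~~ s.2))) /=; last first.
  by exists (fun s => (s.1, ~~ s.2)) => -[i b] _ /=; rewrite negbK.
apply: eq_bigr => -[i b] _.
rewrite (reindex_inj (mulgI (letter_val g (i, b)))) /=.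
apply: eq_bigr => x _; rewrite mulgA.
by case: b; rewrite /letter_val /= ?mulVg ?mulgV mul1g.
Qed.

Lemma iter_adj_selfadjoint g r phi psi :
  dot (iter r (adj g) phi) psi = dot phi (iter r (adj g) psi).
Proof.
by elim: r psi => [|r IH] psi //; rewrite iterS adj_selfadjoint IH -iterSr.
Qed.

(** Squaring the bound at exponent [2 ^ j] and applying Cauchy-Schwarz to [phi] and its [2 ^ j]-th
    iterate doubles the exponent; self-adjointness merges the two iterates into one. *)
Lemma adj_moment g phi j :
  `|dot phi (adj g phi)| ^+ (2 ^ j) <=
    dot phi phi ^+ (2 ^ j).-1 * `|dot phi (iter (2 ^ j) (adj g) phi)|.
Proof.
elim: j => [|j IH]; first by rewrite expn0 expr0 mul1r.
have e0 : (0 < 2 ^ j)%N by rewrite expn_gt0.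
have -> : (2 ^ j.+1)%N = (2 ^ j + 2 ^ j)%N by rewrite expnS mul2n addnn.
have -> : (2 ^ j + 2 ^ j).-1 = ((2 ^ j).-1 + (2 ^ j).-1).+1.
  by case: (2 ^ j)%N e0 => // n _; rewrite addSn addnS.
rewrite iterD -iter_adj_selfadjoint [X in _ * X]ger0_norm ?dot_ge0 //.
rewrite exprD -expr2 (le_trans (_ : _ <= (dot phi phi ^+ (2 ^ j).-1 *
   `|dot phi (iter (2 ^ j) (adj g) phi)|) ^+ 2)) //.
  by rewrite lerXn2r // nnegrE ?exprn_ge0 ?mulr_ge0 ?exprn_ge0 ?dot_ge0.
rewrite exprMn real_normK ?num_real // [_ ^+ (_ + _).+1]exprSr exprD -expr2 -mulrA.
by apply: ler_wpM2l; [apply: sqr_ge0 | apply: dot_CauchySchwarz].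
Qed.

Definition centered_delta (x y : gT) : R := (y == x)%:R - #|gT|%:R^-1.

(** The [t_r] above: the diagonal entry, the same at every vertex, of the [r]-th power of the
    adjacency operator cut down to mean-zero functions. *)
Definition return_excess g r : R :=
  \sum_(w : r.-tuple _) ((word_val g w == 1%g)%:R - #|gT|%:R^-1).

Lemma card_gT_neq0 : #|gT|%:R != 0 :> R.
Proof. by rewrite pnatr_eq0 -lt0n; apply/card_gt0P; exists 1%g. Qed.

Lemma centered_delta_shift (x s : gT) :
  \sum_y centered_delta x y * centered_delta x (s * y)%g
    = (s == 1%g)%:R - #|gT|%:R^-1.
Proof.
rewrite /centered_delta.
have sum1 (z : gT) : \sum_y (y == z)%:R = 1 :> R.
  by rewrite (bigD1 z) //= eqxx big1 ?addr0 // => y /negPf ->.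
under eq_bigr => y _.
  rewrite mulrBl (_ : (s * y == x)%g = (y == (s^-1 * x)%g)); last first.
    by rewrite -(inj_eq (mulgI s^-1%g)) mulKg.
  rewrite [X in _ - X]mulrBr mulrBr.
  over.
rewrite !sumrB -!mulr_suml -!mulr_sumr !sum1 sumr_const.
rewrite (bigD1 x) //= eqxx mul1r big1 ?addr0; last first.
  by move=> y /negPf ->; rewrite mul0r.
have -> : (x == (s^-1 * x)%g) = (s == 1%g).
  by rewrite -(inj_eq (mulgI s)) mulKVg -{2}(mul1g x) (inj_eq (mulIg x)).
rewrite -[X in _ - (_ - X / _)]mulr_natr mulVf ?card_gT_neq0 //; ring.
Qed.

(** Vertex transitivity: the right-hand side does not depend on [x]. *)
Lemma dot_iter_centered_delta g r x :
  dot (iter r (adj g) (centered_delta x)) (iter r (adj g) (centered_delta x))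
    = return_excess g (r + r).
Proof.
rewrite iter_adj_selfadjoint -iterD /dot.
under eq_bigr do rewrite iter_adjE mulr_sumr.
by rewrite exchange_big; apply: eq_bigr => w _; rewrite centered_delta_shift.
Qed.

Lemma return_excess_ge0 g r : 0 <= return_excess g (r + r).
Proof. by rewrite -(dot_iter_centered_delta g r 1%g) dot_ge0. Qed.

(** The function [f] above, written as a sum of point contributions so that each can be treated by
    transitivity. *)
Definition centered_set (X : {set gT}) (y : gT) : R :=
  \sum_(x in X) centered_delta x y.

(** Pointwise Cauchy-Schwarz over the points of [X] costs one factor [#|X|]; the other comes from
    adding [#|X|] equal norms. *)
Lemma dot_iter_centered_set g r X :
  dot (centered_set X) (iter (r + r) (adj g) (centered_set X))
    <= #|X|%:R ^+ 2 * return_excess g (r + r).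
Proof.
rewrite iterD -iter_adj_selfadjoint.
pose F x := iter r (adj g) (centered_delta x).
have iterE y : iter r (adj g) (centered_set X) y = \sum_(x in X) F x y.
  rewrite iter_adjE exchange_big; apply: eq_bigr => x _.
  by rewrite /F iter_adjE.
rewrite (le_trans (_ : _ <= \sum_y #|X|%:R * \sum_(x in X) F x y ^+ 2)) //.
  by apply: ler_sum => y _; rewrite iterE -expr2 sqr_sum_le.
rewrite -mulr_sumr exchange_big expr2 -mulrA ler_wpM2l //=.
under eq_bigr => x _.
  rewrite (_ : \sum_y _ = return_excess g (r + r)); last first.
    by rewrite -(dot_iter_centered_delta g r x).
  over.
by rewrite sumr_const mulr_natl.
Qed.

End Words.

(** * Expected return excess and words without singletons *)

Lemma expr_sum_tuple (A : comPzRingType) (T : finType) (F : T -> A) r :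
  (\sum_s F s) ^+ r = \sum_(w : r.-tuple T) \prod_(s <- w) F s.
Proof.
elim: r => [|r IH].
  by rewrite (big_tuple0 (fun w : seq T => \prod_(s <- w) F s)) big_nil.
rewrite (big_tuple_cons r (fun w : seq T => \prod_(s <- w) F s)) exprS IH mulr_suml.
apply: eq_bigr => s _; rewrite mulr_sumr; apply: eq_bigr => w _.
by rewrite big_cons.
Qed.

Section NoSingleton.

Variables (R : realType) (k : nat).

Definition no_singleton (w : seq ('I_k * bool)) : bool :=
  [forall i, count_mem i (unzip1 w) != 1%N].

(* If some [g i] occurs exactly once in the word, then multiplying [g i] by a
   uniform element makes the value of the word uniform. *)
Lemma sum_word_val_singleton (gT : finGroupType) (w : seq ('I_k * bool)) :
  ~~ no_singleton w ->
  \sum_(g : {ffun 'I_k -> gT}) ((word_val g w == 1%g)%:R - #|gT|%:R^-1) = 0 :> R.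
Proof.
rewrite negb_forall => /existsP[i]; rewrite negbK => /eqP cnt1.
have : i \in unzip1 w by rewrite -has_pred1 has_count cnt1.
case/mapP => -[j b] /[swap] /= <- {j}.
move=> iw; move: cnt1; case: (path.splitPr iw) => u v {iw}.
rewrite /unzip1 map_cat count_cat /= eqxx add1n addnS => -[].
move/eqP; rewrite addn_eq0 => /andP[/eqP/count_memPn iu /eqP/count_memPn iv].
pose sh c (g : {ffun 'I_k -> gT}) := [ffun j => if j == i then (g j * c)%g else g j].
have sh_out c g (s : seq ('I_k * bool)) :
    i \notin unzip1 s -> word_val (sh c g) s = word_val g s.
  move=> is_; apply: eq_big_seq => -[j b'] jb'; rewrite /letter_val ffunE /=.
  by case: eqP => // ji; case/negP: is_; rewrite -ji; apply/mapP; exists (j, b').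
have sh_inj c : injective (sh c).
  move=> g h /ffunP gh; apply/ffunP => j; have := gh j; rewrite !ffunE.
  by case: eqP => // _; apply: mulIg.
(* The generator [g i] enters only through the single letter between [u] and [v], so the word value
   is a bijective function of the shift [c]. *)
have val_inj g : injective (fun c => word_val (sh c g) (u ++ (i, b) :: v)).
  move=> c d; rewrite /word_val !big_cat !big_cons -!/(word_val _ _) !sh_out //.
  move/mulgI/mulIg; rewrite /letter_val /= !ffunE eqxx.
  by case: b => [|/invg_inj] /mulgI.
have sum1 g : \sum_c (word_val (sh c g) (u ++ (i, b) :: v) == 1%g)%:R = 1 :> R.
  transitivity (\sum_(d : gT) (d == 1%g)%:R : R).
    by rewrite [RHS](reindex_inj (val_inj g)).
  by rewrite (bigD1 1%g) //= eqxx big1 ?addr0 // => d /negPf ->.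
have n0 := card_gT_neq0 R gT.
(* After multiplication by [#|gT|] the sum runs over pairs of a shift [c] and a tuple [g]; for each
   [g], exactly one [c] gives the value 1. *)
apply: (mulfI n0); rewrite mulr0 sumrB sumr_const mulrBr [X in _ - X]mulrnAr.
rewrite mulfV //; apply/eqP; rewrite subr_eq0; apply/eqP.
rewrite mulr_natl -sumr_const.
under eq_bigr => c _ do rewrite (reindex_inj (sh_inj c)).
rewrite exchange_big /=.
under eq_bigr => g _ do rewrite sum1.
by rewrite sumr_const.
Qed.

Lemma sum_return_excess_le (gT : finGroupType) r :
  \sum_(g : {ffun 'I_k -> gT}) return_excess R g r <=
    #|{ffun 'I_k -> gT}|%:R * \sum_(w : r.-tuple ('I_k * bool)) (no_singleton w)%:R.
Proof.
rewrite exchange_big mulr_sumr; apply: ler_sum => w _.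
case: (boolP (no_singleton w)) => [_|/sum_word_val_singleton ->]; last by rewrite mulr0.
rewrite mulr1 -[leRHS]sumr_const; apply: ler_sum => g _.
by rewrite lerBlDr -[X in X <= _]addr0 lerD ?invr_ge0 // lern1 leq_b1.
Qed.

(* A centered three-point variable whose moments [(2^c + 2 (-1)^c) / 3] are all
   nonnegative, and at least 1 for [c != 1]. *)
Definition three_point (j : 'I_3) : R := if j == ord0 then 2 else -1.

Lemma sum_three_point (f : R -> R) : \sum_j f (three_point j) = f 2 + f (-1) *+ 2.
Proof. by rewrite !big_ord_recl big_ord0 addr0 /three_point /= mulr2n. Qed.

Lemma three_point_moment_ge (c : nat) :
  (c != 1%N)%:R * 3 <= \sum_j three_point j ^+ c.
Proof.
rewrite (sum_three_point (fun x => x ^+ c)).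
case: c => [|[|c]]; rewrite ?expr0 ?expr1 /=; try lra.
have h1 : 4 <= 2 ^+ c.+2 :> R.
  by rewrite !exprS; have : 1 <= 2 ^+ c :> R; [rewrite exprn_ege1 //; lra | lra].
(* Exponent 2 is separate, as its sign is positive; from exponent 3 on, the power is at least 8 and
   beats the sign term whatever the parity. *)
rewrite -signr_odd /=; case: c h1 => [_|c h1].
  by rewrite /=; lra.
have h2 : 8 <= 2 ^+ c.+3 :> R.
  by rewrite !exprS; have : 1 <= 2 ^+ c :> R; [rewrite exprn_ege1 //; lra | lra].
by case: (odd _); rewrite ?expr0 ?expr1; lra.
Qed.

(** Expanding the power over words, the sum over [z] factors into moments of [three_point]: every
    word contributes a nonnegative amount, and a word without singletons at least [3 ^+ k]. Counting
    thus reduces to a moment of a sum of independent centered variables. *)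
Lemma count_no_singleton_le r :
  3 ^+ k * \sum_(w : r.-tuple ('I_k * bool)) (no_singleton w)%:R <=
    \sum_(z : {ffun 'I_k -> 'I_3}) (2 * \sum_i three_point (z i)) ^+ r.
Proof.
have dbl (z : {ffun 'I_k -> 'I_3}) :
    2 * (\sum_i three_point (z i)) = \sum_(s : 'I_k * bool) three_point (z s.1).
  rewrite -(pair_big xpredT xpredT (fun i (b : bool) => three_point (z i))) /=.
  by rewrite mulr_sumr; apply: eq_bigr => i _; rewrite big_bool /=; ring.
under [leRHS]eq_bigr do rewrite dbl expr_sum_tuple.
rewrite exchange_big mulr_sumr; apply: ler_sum => w _ /=.
have prodE (z : {ffun 'I_k -> 'I_3}) (s : seq ('I_k * bool)) :
    \prod_(l <- s) three_point (z l.1) = \prod_i three_point (z i) ^+ count_mem i (unzip1 s).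
  elim: s => [|[j b] s IH]; first by rewrite big_nil big1.
  rewrite big_cons IH /= [LHS]/=; under [RHS]eq_bigr do rewrite exprD.
  rewrite big_split /=; congr (_ * _).
  by rewrite (bigD1 j) //= eqxx expr1 big1 ?mulr1 // => i; rewrite eq_sym => /negPf ->.
under eq_bigr do rewrite prodE.
rewrite -(bigA_distr_bigA (fun i j => three_point j ^+ count_mem i (unzip1 w))).
case: (boolP (no_singleton w)) => [/forallP ns|_]; last first.
  rewrite mulr0; apply: prodr_ge0 => i _.
  by apply: le_trans (three_point_moment_ge _); rewrite mulr_ge0.
rewrite mulr1 -[k in 3 ^+ k]card_ord -prodr_const; apply: ler_prod => i _.
have := three_point_moment_ge (count_mem i (unzip1 w)).
by rewrite ns mul1r => -> ; rewrite ler0n.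
Qed.

(** Since exp(-y) is at least 1 - y, it suffices that (1 - y)(1 + y + 2y^2) = 1 + y^2 (1 - 2y) is at
    least 1. *)
Lemma expR_le_quadratic (y : R) : y <= 1 / 2 -> expR y <= 1 + y + 2 * y ^+ 2.
Proof.
move=> y2; set q := 1 + y + _.
have q0 : 0 <= q.
  by have := sqr_ge0 (y + 1 / 4); rewrite /q !expr2; lra.
have q1 : 1 <= (1 - y) * q.
  have := mulr_ge0 (sqr_ge0 y) (_ : 0 <= 1 - 2 * y).
  by rewrite /q !expr2 => /(_ ltac:(lra)); lra.
rewrite -[leRHS]mul1r -(expRxMexpNx_1 y) -mulrA ler_peMr ?expR_ge0 //.
by apply: le_trans q1 _; rewrite ler_wpM2r // expR_ge1Dx.
Qed.

(** A single term of the exponential series at |y|, with exp |y| at most exp y + exp(-y). *)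
Lemma expr_le_expR (N : nat) (x s : R) : (0 < N)%N -> ~~ odd N ->
  (x * s) ^+ N <= N`!%:R * (expR (x * s) + expR (- x * s)).
Proof.
case: N => // N _ eN; rewrite mulNr; set y := x * s.
have -> : y ^+ N.+1 = `|y| ^+ N.+1.
  by rewrite -normrX ger0_norm // exprn_even_ge0.
have h := expR_ge1Dxn N (normr_ge0 y).
rewrite -[leLHS](@mulfVK _ (N.+1)`!%:R) ?pnatr_eq0 -?lt0n ?fact_gt0 //.
rewrite mulrC ler_wpM2l //.
have := expR_gt0 y; have := expR_gt0 (- y).
by case: (ger0P y) h => _; lra.
Qed.

(** The sum factors over coordinates. In each factor the linear terms cancel, leaving 3 + 12x^2; the
    bound on [x] keeps both exponents 2x and -x below 1/2. *)
Lemma three_point_mgf_le (x : R) : `|x| <= 1 / 4 ->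
  \sum_(z : {ffun 'I_k -> 'I_3}) expR (x * \sum_i three_point (z i))
    <= 3 ^+ k * expR (4 * x ^+ 2) ^+ k.
Proof.
rewrite ler_norml => /andP[x1 x2].
under eq_bigr do rewrite mulr_sumr expR_sum.
rewrite -(bigA_distr_bigA (fun i j => expR (x * three_point j))) /=.
rewrite prodr_const card_ord -exprMn lerXn2r ?nnegrE ?mulr_ge0 ?expR_ge0 //.
  by apply: sumr_ge0 => j _; rewrite expR_ge0.
rewrite (sum_three_point (fun y => expR (x * y))).
have hb : expR (x * 2) <= 1 + x * 2 + 2 * (x * 2) ^+ 2.
  by apply: expR_le_quadratic; lra.
have hc : expR (x * -1) <= 1 + x * -1 + 2 * (x * -1) ^+ 2.
  by apply: expR_le_quadratic; lra.
have ha := expR_ge1Dx (4 * x ^+ 2).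
apply: (@le_trans _ _ (3 * (1 + 4 * x ^+ 2))); last by rewrite ler_wpM2l.
by rewrite mulr2n; move: hb hc; rewrite !expr2; lra.
Qed.

Lemma count_no_singleton (p : nat) : (0 < p)%N -> (p + p <= k)%N ->
  \sum_(w : (p + p).-tuple ('I_k * bool)) (no_singleton w)%:R
    <= (256 * (k%:R * (p + p)%:R)) ^+ p :> R.
Proof.
move=> p0 pk; set N := (p + p)%N.
have N0 : 0 < N%:R :> R by rewrite ltr0n addn_gt0 p0.
have k0 : 0 < k%:R :> R by rewrite ltr0n (leq_trans _ pk) // addn_gt0 p0.
(* This choice makes the exponential factor exp(4 k x^2) = exp(p/2), at most 2^p, and [N <= k] gives
   [x <= 1 / 4]. *)
pose x : R := Num.sqrt (N%:R / (16 * k%:R)).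
have x2 : x ^+ 2 = N%:R / (16 * k%:R).
  by rewrite sqr_sqrtr // divr_ge0 ?mulr_ge0 // ltW.
have x2gt0 : 0 < x ^+ 2 by rewrite x2 divr_gt0 ?mulr_gt0.
have x0 : 0 < x by rewrite sqrtr_gt0 divr_gt0 ?mulr_gt0.
have x4 : x <= 1 / 4.
  rewrite -(@ler_pXn2r _ 2) ?nnegrE ?(ltW x0) //; last lra.
  rewrite x2 ler_pdivrMr ?mulr_gt0 // (le_trans (_ : _ <= k%:R)) ?ler_nat //.
  by rewrite expr2; lra.
have t3 : 0 < 3 ^+ k :> R by rewrite exprn_gt0.
rewrite -(ler_pM2l t3); apply: le_trans (count_no_singleton_le _) _.
rewrite -(@ler_pM2l _ ((x ^+ 2) ^+ p)) ?exprn_gt0 //.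
have -> : (x ^+ 2) ^+ p * (\sum_(z : {ffun 'I_k -> 'I_3}) (2 * (\sum_i three_point (z i))) ^+ N)
  = 4 ^+ p * \sum_(z : {ffun 'I_k -> 'I_3}) (x * \sum_i three_point (z i)) ^+ N.
  rewrite !mulr_sumr; apply: eq_bigr => z _.
  rewrite /N addnn -mul2n !exprM -!exprMn; congr (_ ^+ p); ring.
have B : \sum_(z : {ffun 'I_k -> 'I_3}) (x * \sum_i three_point (z i)) ^+ N
   <= N`!%:R * (2 * (3 ^+ k * expR (4 * x ^+ 2) ^+ k)).
  apply: (@le_trans _ _ (N`!%:R * (\sum_(z : {ffun 'I_k -> 'I_3})
    (expR (x * \sum_i three_point (z i)) + expR (- x * \sum_i three_point (z i)))))).
    rewrite mulr_sumr; apply: ler_sum => z _; apply: expr_le_expR.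
      by rewrite /N addn_gt0 p0.
    by rewrite /N addnn odd_double.
  rewrite ler_wpM2l // big_split /= mulr_natl mulr2n lerD //.
    by apply: three_point_mgf_le; rewrite gtr0_norm.
  by rewrite -(sqrrN x); apply: three_point_mgf_le; rewrite normrN gtr0_norm.
apply: (@le_trans _ _ (4 ^+ p * (N`!%:R * (2 * (3 ^+ k * expR (4 * x ^+ 2) ^+ k))))).
  by rewrite ler_wpM2l // exprn_ge0.
have expE : expR (4 * x ^+ 2) ^+ k <= 2 ^+ p.
  rewrite -expRM_natr x2.
  have -> : 4 * (N%:R / (16 * k%:R)) * k%:R = 1 / 2 * p%:R :> R.
    by rewrite /N natrD; field; rewrite gt_eqF.
  rewrite expRM_natr lerXn2r ?nnegrE ?expR_ge0 //.
  by have := @expR_le_quadratic (1 / 2) (lexx _); rewrite expr2; lra.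
have factE : N`!%:R <= (N%:R ^+ 2) ^+ p :> R.
  rewrite -exprM mul2n -addnn -/N -natrX ler_nat.
  elim: (N) => // m IH; rewrite factS expnS leq_mul //.
  by apply: leq_trans IH _; case: m => // m; rewrite leq_exp2r.
have twoE : 2 <= 2 ^+ p :> R.
  by rewrite -[leLHS]expr1 ler_eXn2l // ltr1n.
(* The constant is 256 = 16 * 4 * 2 * 2: from [x], from the two signs of each letter, from the
   prefactor 2, and from the exponential. *)
have -> : (x ^+ 2) ^+ p * (3 ^+ k * (256 * (k%:R * N%:R)) ^+ p) =
   4 ^+ p * ((N%:R ^+ 2) ^+ p * (2 ^+ p * (3 ^+ k * 2 ^+ p))).
  rewrite (mulrCA _ (3 ^+ k)) -!(mulrCA (3 ^+ k)) -!exprMn; congr (_ * _ ^+ p).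
  by rewrite x2; field; rewrite gt_eqF.
rewrite ler_wpM2l ?exprn_ge0 //.
apply: ler_pM => //; first by rewrite !mulr_ge0 ?exprn_ge0 ?expR_ge0.
apply: ler_pM => //; first by rewrite !mulr_ge0 ?exprn_ge0 ?expR_ge0.
by rewrite ler_wpM2l // ltW.
Qed.

End NoSingleton.

(** * The cut as a quadratic form *)

Section Cut.

Variables (R : realType) (gT : finGroupType) (k : nat).
Implicit Types (g : {ffun 'I_k -> gT}) (X : {set gT}).

Lemma cayley_edgesE g X (Y : {set gT}) :
  (cayley_edges g X Y)%:R =
    \sum_(s : 'I_k * bool) \sum_(x in X) (letter_val g s * x \in Y)%g%:R :> R.
Proof.
rewrite exchange_big natr_sum; apply: eq_bigr => x _.
rewrite -(pair_big xpredT xpredT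
  (fun i (b : bool) => (letter_val g (i, b) * x \in Y)%g%:R)) /=.
rewrite /cayley_gens count_flatten -map_comp sumnE big_map natr_sum big_enum.
apply: eq_bigr => i _.
by rewrite big_bool /= addn0 natrD.
Qed.

Definition set_variance X : R := #|X|%:R - #|X|%:R ^+ 2 / #|gT|%:R.

Lemma set_varianceE X : set_variance X = #|X|%:R * #|~: X|%:R / #|gT|%:R.
Proof.
have -> : #|~: X|%:R = #|gT|%:R - #|X|%:R :> R.
  by rewrite -(cardsC X) natrD addrC addKr.
by rewrite /set_variance; field; apply: card_gT_neq0.
Qed.

Lemma centered_setE X y : centered_set R X y = (y \in X)%:R - #|X|%:R / #|gT|%:R.
Proof.
rewrite /centered_set /centered_delta sumrB sumr_const mulr_natl; congr (_ - _).
case: (boolP (y \in X)) => yX.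
  by rewrite (bigD1 y) //= eqxx big1 ?addr0 // => x /andP[_]; rewrite eq_sym => /negPf ->.
by rewrite big1 // => x xX; case: eqP => // yx; rewrite yx xX in yX.
Qed.

Lemma sum_mem_set X : \sum_(y : gT) (y \in X)%:R = #|X|%:R :> R.
Proof. by rewrite -sum1_card natr_sum [RHS]big_mkcond; apply: eq_bigr => y _; case: ifP. Qed.

(** Autocorrelation of [f] under a translation: each point of [X] carried outside [X] lowers it by
    one. Summing over letters turns the quadratic form into the edge count. *)
Lemma centered_set_shift X (s : gT) :
  \sum_y centered_set R X y * centered_set R X (s * y)%g
    = set_variance X - \sum_(y in X) (s * y \in ~: X)%g%:R.
Proof.
have -> : \sum_(y in X) (s * y \in ~: X)%g%:R =
    #|X|%:R - \sum_y (y \in X)%:R * (s * y \in X)%g%:R :> R.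
  rewrite -sum_mem_set -sumrB [LHS]big_mkcond; apply: eq_bigr => y _.
  by rewrite inE; case: (y \in X); case: (_ \in X) => /=; ring.
have shiftX : \sum_y (s * y \in X)%g%:R = #|X|%:R :> R.
  by rewrite -sum_mem_set [RHS](reindex_inj (mulgI s)).
under eq_bigr do rewrite !centered_setE mulrBl [X in _ - X]mulrBr mulrBr.
rewrite !sumrB -!mulr_suml -!mulr_sumr sum_mem_set sumr_const.
rewrite shiftX.
rewrite -[#|X|%:R *+ _]mulr_natr /set_variance.
by field; apply: card_gT_neq0.
Qed.

Lemma dot_centered_set X : dot (centered_set R X) (centered_set R X) = set_variance X.
Proof.
transitivity (\sum_y centered_set R X y * centered_set R X (1 * y)%g).
  by apply: eq_bigr => y _; rewrite mul1g.
by rewrite centered_set_shift big1 ?subr0 // => y yX; rewrite mul1g inE yX.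
Qed.

Lemma dot_adj_centered_set g X :
  dot (centered_set R X) (adj g (centered_set R X))
    = 2 * k%:R * set_variance X - (cayley_edges g X (~: X))%:R.
Proof.
rewrite /dot /adj; under eq_bigr do rewrite mulr_sumr.
rewrite exchange_big; under eq_bigr do rewrite centered_set_shift.
rewrite sumrB -cayley_edgesE sumr_const card_prod card_bool card_ord -[X in X - _]mulr_natl.
by rewrite natrM (mulrC k%:R).
Qed.

Definition cut_defect g X : R :=
  (cayley_edges g X (~: X))%:R / (2 * k%:R / #|gT|%:R * #|X|%:R * #|~: X|%:R) - 1.

Hypothesis k0 : (0 < k)%N.

Section SmallSet.

Variable X : {set gT}.
Hypothesis X1 : (1 < #|X|)%N.
Hypothesis Xhalf : #|X|%:R <= #|gT|%:R / 2 :> R.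

Lemma set_variance_ge : #|X|%:R / 2 <= set_variance X.
Proof.
have n0 : 0 < #|gT|%:R :> R by rewrite lt0r card_gT_neq0 ler0n.
have m0 : 0 < #|X|%:R :> R by rewrite ltr0n ltnW.
suff : #|X|%:R ^+ 2 / #|gT|%:R <= #|X|%:R / 2 :> R by rewrite /set_variance; lra.
have : #|X|%:R * #|X|%:R <= #|X|%:R * (#|gT|%:R / 2) :> R by rewrite ler_pM2l.
by rewrite ler_pdivrMr // expr2; lra.
Qed.

Lemma set_variance_gt0 : 0 < set_variance X.
Proof.
apply: lt_le_trans set_variance_ge; rewrite divr_gt0 //.
by rewrite ltr0n ltnW.
Qed.

Lemma cut_defectE g :
  cut_defect g X = - (dot (centered_set R X) (adj g (centered_set R X))
                      / (2 * k%:R * set_variance X)).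
Proof.
have kR : k%:R != 0 :> R by rewrite pnatr_eq0 -lt0n.
rewrite dot_adj_centered_set /cut_defect.
have -> : 2 * k%:R / #|gT|%:R * #|X|%:R * #|~: X|%:R = 2 * k%:R * set_variance X :> R.
  by rewrite set_varianceE; field; apply: card_gT_neq0.
by field; rewrite kR gt_eqF ?set_variance_gt0.
Qed.

(** The trivial bound: there are at most 2k|X| crossing edges and the variance is at least |X|/2, so
    the ratio lies between 0 and 2. *)
Lemma cut_defect_le1 g : `|cut_defect g X| <= 1.
Proof.
have kR : 0 < k%:R :> R by rewrite ltr0n.
have v0 := set_variance_gt0.
rewrite cut_defectE normrN normrM normfV [X in _ / X]gtr0_norm ?mulr_gt0 //.
rewrite ler_pdivrMr ?mulr_gt0 // mul1r dot_adj_centered_set ler_norml.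
have e0 : 0 <= (cayley_edges g X (~: X))%:R :> R by [].
have e1 : (cayley_edges g X (~: X))%:R <= 2 * k%:R * #|X|%:R :> R.
  rewrite cayley_edgesE.
  apply: (@le_trans _ _ (\sum_(s : 'I_k * bool) #|X|%:R)).
    apply: ler_sum => s _; rewrite -sum1_card natr_sum; apply: ler_sum => x _.
    by rewrite ler_nat leq_b1.
  by rewrite sumr_const card_prod card_bool card_ord -[leLHS]mulr_natl natrM (mulrC k%:R).
have : 2 * k%:R * (#|X|%:R / 2) <= 2 * k%:R * set_variance X :> R.
  by rewrite ler_pM2l ?mulr_gt0 // set_variance_ge.
set v := 2 * k%:R * set_variance X; move=> h; apply/andP; split; lra.
Qed.

(** One power of the variance survives in the denominator; being at least |X|/2, it reduces the
    factor |X|^2 to 2|X|. *)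
Lemma cut_defect_moment g j :
  `|cut_defect g X| ^+ (2 ^ j + 2 ^ j) <=
    2 * #|X|%:R * return_excess R g (2 ^ j + 2 ^ j) / (2 * k%:R) ^+ (2 ^ j + 2 ^ j).
Proof.
have kR : 0 < 2 * k%:R :> R by rewrite mulr_gt0 // ltr0n.
have v0 := set_variance_gt0.
have m0 : 0 < #|X|%:R :> R by rewrite ltr0n ltnW.
have t0 := return_excess_ge0 R g (2 ^ j).
have := adj_moment g (centered_set R X) j.+1.
rewrite expnS mul2n -addnn; set N := (2 ^ j + 2 ^ j)%N in t0 *.
have N0 : (0 < N)%N by rewrite addn_gt0 expn_gt0.
rewrite dot_centered_set => mom.
rewrite cut_defectE normrN normrM normfV [X in _ / X]gtr0_norm ?mulr_gt0 ?ltr0n //.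
rewrite expr_div_n exprMn ler_pdivrMr ?mulr_gt0 ?exprn_gt0 //.
apply: le_trans mom _.
rewrite mulrA mulfVK ?gt_eqF ?exprn_gt0 // mulrC.
rewrite -[N in leRHS]prednK // exprS mulrA ler_wpM2r ?exprn_ge0 ?(ltW v0) //.
rewrite ger0_norm; last first.
  by rewrite /N iterD -iter_adj_selfadjoint dot_ge0.
apply: le_trans (dot_iter_centered_set R g (2 ^ j) X) _.
rewrite prednK // -/N.
have -> : #|X|%:R ^+ 2 * return_excess R g N =
    2 * #|X|%:R * return_excess R g N * (#|X|%:R / 2) by field.
by rewrite ler_wpM2l ?set_variance_ge // !mulr_ge0 // ltW.
Qed.

Lemma ln2_ge : 1 / 2 <= ln 2 :> R.
Proof.
rewrite -ler_expR lnK ?posrE //.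
by have := @expR_le_quadratic R (1 / 2) (lexx _); rewrite expr2; lra.
Qed.

(* [N = 2p] is the power of two with [log2 |X| < N <= 4 ln |X|]. *)
Lemma cut_defect_le g :
  (forall j, (2 ^ j + 2 ^ j <= k)%N ->
    return_excess R g (2 ^ j + 2 ^ j) <=
      (4096 * (k%:R * (2 ^ j + 2 ^ j)%:R)) ^+ (2 ^ j)) ->
  `|cut_defect g X| <= 256 * Num.sqrt (ln #|X|%:R / k%:R).
Proof.
move=> small.
have kR : 0 < k%:R :> R by rewrite ltr0n.
set m := #|X|; have m1 : (1 < m)%N := X1; pose L := trunc_log 2 m.
have [Lm mL] : (2 ^ L <= m)%N /\ (m < 2 ^ L.+1)%N.
  by apply/andP; apply: trunc_log_bounds => //; apply: ltnW.
have L0 : (0 < L)%N by rewrite trunc_log_gt0.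
(* This yields 2^j <= L < 2^(j+1). Hence N = 2^(j+1) satisfies |X| < 2^(L+1) <= 2^N and N <= 2L;
   [L0] rules out a zero [up_log]. *)
have := @up_log_bounds 2 L.+1 isT L0; case: (up_log 2 L.+1) => [|j] /= /andP[].
  by move=> _; rewrite expn0 ltnNge L0.
rewrite ltnS expnS mul2n -addnn => jL Lj.
have m0 : 0 < m%:R :> R by rewrite ltr0n ltnW.
have lnm : L%:R / 2 <= ln m%:R :> R.
  apply: (@le_trans _ _ (ln (2 ^ L)%:R)); last first.
    by rewrite ler_ln ?posrE ?ltr0n ?expn_gt0 // ?ler_nat // ltnW.
  rewrite natrX lnXn // -[leRHS]mulr_natl ler_wpM2l //.
  by have := ln2_ge; lra.
have jlnm : (2 ^ j + 2 ^ j)%:R <= 4 * ln m%:R :> R.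
  have : (2 ^ j)%:R <= L%:R :> R by rewrite ler_nat.
  by rewrite natrD; lra.
set p := (2 ^ j)%N in jL Lj jlnm; set N := (p + p)%N in Lj jlnm.
have p0 : (0 < p)%N by rewrite expn_gt0.
have lnm0 : 0 <= ln m%:R :> R.
  by apply: le_trans lnm; rewrite divr_ge0.
have [kN|kN] := leqP N k; last first.
  (* Here k < N <= 4 ln |X|, so the square root is at least 1/4 and the right-hand side exceeds
     1. *)
  apply: le_trans (cut_defect_le1 g) _.
  have q : (1 / 4) ^+ 1 <= ln m%:R / k%:R :> R.
    rewrite ler_pdivlMr // expr1.
    by have : k%:R <= N%:R :> R; [rewrite ler_nat ltnW | lra].
  have : Num.sqrt ((1 / 4) ^+ 2) <= Num.sqrt (ln m%:R / k%:R) :> R.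
    by apply: ler_wsqrtr; apply: le_trans q; rewrite expr2; lra.
  by rewrite sqrtr_sqr ger0_norm; lra.
rewrite -(@ler_pXn2r _ N) ?addn_gt0 ?p0 // ?nnegrE ?mulr_ge0 ?sqrtr_ge0 //.
apply: le_trans (cut_defect_moment g j) _; rewrite -/p -/N.
(* The factor 2|X| is at most 4^N, so it costs only a constant after the N-th root. *)
apply: (@le_trans _ _ (4 ^+ N * (4096 * (k%:R * N%:R)) ^+ p / (2 * k%:R) ^+ N)).
  rewrite ler_pM2r ?invr_gt0 ?exprn_gt0 ?mulr_gt0 //.
  apply: ler_pM; rewrite ?mulr_ge0 ?(ltW m0) ?return_excess_ge0 //; last exact: small.
  rewrite -natrM -natrX ler_nat.
  apply: (@leq_trans (2 * 2 ^ N)); last first.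
    rewrite -[4%N]/(2 * 2)%N expnMn leq_mul // -[X in (X <= _)%N]expn1 leq_exp2l //.
    by rewrite addn_gt0 p0.
  by rewrite leq_mul2l (leq_trans (ltnW mL)) // leq_exp2l.
rewrite [in leRHS]exprMn /N addnn -mul2n !exprM sqr_sqrtr ?divr_ge0 //.
rewrite -!exprMn -exprVn -exprMn lerXn2r ?nnegrE ?mulr_ge0 ?invr_ge0 ?exprn_ge0 ?mulr_ge0 ?(ltW kR) //.
rewrite mul2n -addnn -/N.
have -> : 4 ^+ 2 * (4096 * (k%:R * N%:R)) / (2 * k%:R) ^+ 2 = 16384 * (N%:R / k%:R) :> R.
  by field; rewrite gt_eqF.
(* The constant 256 is exact here: 256^2 = 4 * 16384, the 4 coming from N <= 4 ln |X|. *)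
have -> : 256 ^+ 2 * (ln m%:R / k%:R) = 16384 * (4 * ln m%:R / k%:R) :> R.
  by field; rewrite gt_eqF.
by rewrite ler_pM2l // ler_pM2r ?invr_gt0.
Qed.

End SmallSet.

End Cut.

(** * Markov's inequality and the union bound *)

Section Probability.

Variables (R : realType) (gT : finGroupType) (k : nat).
Local Notation gens := {ffun 'I_k -> gT}.

Lemma iid_uniform_probE (E : pred gens) :
  iid_uniform_prob R E = (\sum_g (E g)%:R) / #|gens|%:R.
Proof.
rewrite /iid_uniform_prob mulr_suml big_mkcond; apply: eq_bigr => g _.
rewrite prodr_const card_ffun !card_ord natrX -exprVn.
by case: (E g); rewrite ?mul1r ?mul0r.
Qed.

(** The constant 4096 is 16 times the 256 of [count_no_singleton], so that Markov's inequality gives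
    failure probability at most 16^-(2^j). *)
Definition excess_bound (j : nat) (g : gens) : bool :=
  return_excess R g (2 ^ j + 2 ^ j) <=
    (4096 * (k%:R * (2 ^ j + 2 ^ j)%:R)) ^+ (2 ^ j).

(** Markov's inequality, valid because return excesses of even length are nonnegative. *)
Lemma excess_bound_fail j : (2 ^ j + 2 ^ j <= k)%N ->
  \sum_g (~~ excess_bound j g)%:R <= #|gens|%:R * (1 / 16) ^+ (2 ^ j) :> R.
Proof.
move=> jk; rewrite /excess_bound; set p := (2 ^ j)%N in jk *; set N := (p + p)%N in jk *.
have p0 : (0 < p)%N by rewrite expn_gt0.
have kN0 : 0 < k%:R * N%:R :> R.
  by rewrite -natrM ltr0n muln_gt0 (leq_trans _ jk) addn_gt0 p0.
set T := (4096 * _) ^+ p.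
have T0 : 0 < T by rewrite exprn_gt0 // mulr_gt0.
rewrite -(ler_pM2r T0) mulr_suml.
apply: (@le_trans _ _ (\sum_g return_excess R g N)).
  apply: ler_sum => g _; case: (leP (return_excess R g N) T) => h /=.
    by rewrite mul0r return_excess_ge0.
  by rewrite mul1r ltW.
apply: le_trans (sum_return_excess_le R k gT N) _.
rewrite -mulrA ler_wpM2l // (le_trans (count_no_singleton _ p0 jk)) //.
by rewrite /T -/N -exprMn le_eqVlt; apply/orP; left; apply/eqP; congr (_ ^+ p); field.
Qed.

Lemma sum_sixteenth_le n : \sum_(j < n) (1 / 16) ^+ (2 ^ j) <= 1 / 2 :> R.
Proof.
(* The subtracted term makes the induction close: 16^-(2^n) is at most 16^-(n+1), hence at most
   2^-(n+2). *)
suff : \sum_(j < n) (1 / 16) ^+ (2 ^ j) <= 1 / 2 - (1 / 2) ^+ n.+1 :> R.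
  by have : 0 <= (1 / 2) ^+ n.+1 :> R; [rewrite exprn_ge0 ?divr_ge0 | lra].
elim: n => [|n IH]; first by rewrite big_ord0 expr1 subrr.
rewrite big_ord_recr /=.
suff : (1 / 16) ^+ (2 ^ n) <= (1 / 2) ^+ n.+2 :> R.
  by rewrite (exprS _ n.+1); move: (_ ^+ n.+1) IH => h; lra.
apply: (@le_trans _ _ ((1 / 16) ^+ n.+1)).
  by apply: ler_wiXn2l; [lra | lra | rewrite ltn_expl].
have -> : 1 / 16 = (1 / 2) ^+ 4 :> R by rewrite !exprS expr0; lra.
rewrite -exprM; apply: ler_wiXn2l; [lra | lra | ].
by rewrite mulnS -(addn2 n) addnC leq_add // leq_pmull.
Qed.

Lemma prob_excess_bound (E : pred gens) :
  (forall g, (forall j, (2 ^ j + 2 ^ j <= k)%N -> excess_bound j g) -> E g) ->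
  1 / 2 <= iid_uniform_prob R E.
Proof.
move=> goodE.
have M0 : 0 < #|gens|%:R :> R.
  by rewrite ltr0n; apply/card_gt0P; exists [ffun=> 1%g].
rewrite iid_uniform_probE ler_pdivlMr //.
have fail : \sum_g (~~ E g)%:R <= #|gens|%:R * (1 / 2) :> R.
  (* Union bound; indices below [k] suffice, since 2^j + 2^j <= k forces j < k. *)
  apply: (@le_trans _ _ (\sum_(j < k | (2 ^ j + 2 ^ j <= k)%N)
                           \sum_g (~~ excess_bound j g)%:R)).
    rewrite exchange_big; apply: ler_sum => g _.
    case: (boolP (E g)) => [_|nE]; first by apply: sumr_ge0.
    have [j jk nj] : exists2 j : 'I_k, (2 ^ j + 2 ^ j <= k)%N & ~~ excess_bound j g.
      apply/exists_inP; apply: contraR nE; rewrite negb_exists_in => /forall_inP ok.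
      apply: goodE => j jk.
      have jk' : (j < k)%N.
        by apply: leq_trans jk; apply: ltn_addr; rewrite ltn_expl.
      by have := ok (Ordinal jk') jk; rewrite negbK.
    by rewrite (bigD1 j) //= nj lerDl; apply: sumr_ge0.
  apply: (@le_trans _ _ (\sum_(j < k | (2 ^ j + 2 ^ j <= k)%N)
                           #|gens|%:R * (1 / 16) ^+ (2 ^ j))).
    by apply: ler_sum => j; apply: excess_bound_fail.
  rewrite -mulr_sumr ler_wpM2l //; apply: le_trans (sum_sixteenth_le k).
  by rewrite big_mkcond; apply: ler_sum => j _; case: ifP => // _; rewrite exprn_ge0 ?divr_ge0.
have total : \sum_g (E g)%:R + \sum_g (~~ E g)%:R = #|gens|%:R :> R.
  rewrite -big_split /= -[RHS]sumr_const; apply: eq_bigr => g _.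
  by case: (E g); rewrite ?addr0 ?add0r.
by lra.
Qed.

End Probability.

Theorem theorem1p7 (R : realType) :
  exists C : R, 0 < C /\
    forall (k : nat) (gT : finGroupType), (0 < k)%N ->
      1 / 2 <= iid_uniform_prob R (fun g : {ffun 'I_k -> gT} =>
        [forall X : {set gT},
           (1 < #|X|)%N && (#|X|%:R <= #|gT|%:R / 2 :> R) ==>
           (`| (cayley_edges g X (~: X))%:R
                 / ((2 * k%:R) / #|gT|%:R * #|X|%:R * #|~: X|%:R) - 1 |
              <= C * Num.sqrt (ln (#|X|%:R) / k%:R))]).
Proof.
exists 256; split => // k gT k0; apply: prob_excess_bound => g good.
apply/forallP => X; apply/implyP => /andP[X1 Xhalf].
exact: cut_defect_le.
Qed.
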